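(* Let $A\in\mathbb{C}^{q\times n}$, let $W\in\mathbb{C}^{n\times q}$ be nonzero, let $B\in\mathbb{C}^{n\times p}$, let $m$ be a positive integer and let $k=\max\{\mathrm{Ind}(AW),\mathrm{Ind}(WA)\}$. Then the constrained matrix approximation problem $$\min_{\mathcal{R}(X)\subseteq\mathcal{R}((AW)^k)}\Vert WA^{\star(m+1)}WX-WA^{\star m}B\Vert_F$$ over $X\in\mathbb{C}^{q\times p}$ has the unique solution $X=A^{\mathrm{wg}_m,W}B$.
   Context: $\Vert\cdot\Vert_F$ is the Frobenius norm and $\mathcal{R}(M)$ the range of a complex matrix $M$. For square $M$: $M^0=I$, $\mathrm{Ind}(M)$ is the smallest nonnegative integer $k$ with $\mathrm{rank}(M^k)=\mathrm{rank}(M^{k+1})$; the core-EP inverse $M^{\mathrm{cEP}}$ is the unique $X$ with $XMX=X$ and $\mathcal{R}(X)=\mathcal{R}(X^* )=\mathcal{R}(M^{\mathrm{Ind}(M)})$. For $X,Y\in\mathbb{C}^{q\times n}$ the $W$-product is $X\star Y=XWY$, and $X^{\star l}$ is the $l$-fold $W$-product of $X$ with itself. The weighted core-EP inverse is $A^{\mathrm{cEP},W}=A((WA)^{\mathrm{cEP}})^2$; the $W$-weighted $m$-weak group inverse is $A^{\mathrm{wg}_m,W}=(A^{\mathrm{cEP},W})^{\star(m+1)}WA^{\star m}\in\mathbb{C}^{q\times n}$. *)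

(* Defs.v *)
From HB Require Import structures.
From mathcomp Require Import all_boot all_order all_algebra.
From mathcomp Require Import boolp classical_sets reals complex.

Set Implicit Arguments.
Unset Strict Implicit.
Unset Printing Implicit Defensive.

Import Order.TTheory GRing.Theory Num.Theory.

Local Open Scope classical_set_scope.
Local Open Scope ring_scope.
Local Open Scope sesquilinear_scope.
Local Open Scope complex_scope.

Definition mx_frobenius (R : realType) (m n : nat) (M : 'M[R[i]]_(m, n)) : R :=
  Num.sqrt (\sum_i \sum_j ComplexField.Normc.normc (M i j) ^+ 2).

(* The column space: matrices act on column vectors, in contrast with the
   row spaces of mxalgebra. *)
Definition mx_range (R : realType) (m n : nat) (M : 'M[R[i]]_(m, n)) :
  set 'cV[R[i]]_m := range (fun u : 'cV[R[i]]_n => M *m u).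

Lemma mxpower_index_subproof (F : fieldType) (n : nat) (M : 'M[F]_n) :
  exists k, \rank (M ^+ k) == \rank (M ^+ k.+1).
Proof.
have [/existsP[k Hk]|/existsPn H] :=
  boolP [exists k : 'I_n.+1, \rank (M ^+ k) == \rank (M ^+ k.+1)].
  by exists k.
have Hr k : (k <= n.+1 -> \rank (M ^+ k)%R + k <= n)%N.
  elim: k => [_|k IHk lt_kn]; first by rewrite addn0 rank_leq_row.
  apply: leq_trans (IHk (ltnW lt_kn)); rewrite addnS ltn_add2r ltn_neqAle.
  by rewrite eq_sym (H (Ordinal lt_kn)) exprS mxrankM_maxr.
by have := leq_trans (leq_addl _ _) (Hr n.+1 (leqnn _)); rewrite ltnn.
Qed.

Definition mxpower_index (F : fieldType) (n : nat) (M : 'M[F]_n) : nat :=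
  ex_minn (mxpower_index_subproof M).

Definition is_core_ep (R : realType) (n : nat) (M X : 'M[R[i]]_n) : Prop :=
  [/\ X *m M *m X = X,
      mx_range X = mx_range (X ^t*) &
      mx_range (X ^t*) = mx_range (M ^+ mxpower_index M)].

(* is_core_ep M is satisfied by exactly one matrix, so the default value 0 is
   never used. *)
Definition core_ep (R : realType) (n : nat) (M : 'M[R[i]]_n) : 'M[R[i]]_n :=
  xget 0 [set X | is_core_ep M X].

Definition wmul (R : realType) (q n : nat) (W : 'M[R[i]]_(n, q))
    (X Y : 'M[R[i]]_(q, n)) : 'M[R[i]]_(q, n) := X *m W *m Y.

(* wmul has no unit, so the l-fold product is meaningful only for l > 0 (it
   is set to 0 when l = 0). *)
Definition wexp (R : realType) (q n : nat) (W : 'M[R[i]]_(n, q))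
    (X : 'M[R[i]]_(q, n)) (l : nat) : 'M[R[i]]_(q, n) :=
  iterop l (wmul W) X 0.

Definition wcore_ep (R : realType) (q n : nat) (W : 'M[R[i]]_(n, q))
    (A : 'M[R[i]]_(q, n)) : 'M[R[i]]_(q, n) := A *m core_ep (W *m A) ^+ 2.

Definition wm_weak_group (R : realType) (q n : nat) (W : 'M[R[i]]_(n, q))
    (m : nat) (A : 'M[R[i]]_(q, n)) : 'M[R[i]]_(q, n) :=
  wexp W (wcore_ep W A) m.+1 *m W *m wexp W A m.

Definition is_minimizer (R : realType) (T : Type) (D : set T) (f : T -> R)
    (x : T) : Prop := D x /\ forall y, D y -> f x <= f y.

(* Main.v *)
(** Put N = WA and let C be the core-EP inverse of N. The objective is
    ||N^(m+1) W X - N^m B||, and X |-> N^(m+1) W X sends the candidate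
    X0 = A C^(m+2) N^m B to N C N^m B. For feasible X the matrix N^(m+1) W X
    has its range in that of N^k, hence in that of C^*, while C annihilates
    N C N^m B - N^m B because C N C = C. The squared objective thus splits
    orthogonally into ||N^(m+1) W (X - X0)||^2 and a constant. Multiplying by A
    shows that N^(m+1) W is injective on R((AW)^k), whence uniqueness. *)
Require Import Defs.
From mathcomp Require Import all_boot all_order all_algebra.
From mathcomp Require Import boolp classical_sets reals complex.

Set Implicit Arguments.
Unset Strict Implicit.
Unset Printing Implicit Defensive.

Import Order.TTheory GRing.Theory Num.Theory.

Local Open Scope classical_set_scope.
Local Open Scope ring_scope.
Local Open Scope sesquilinear_scope.
Local Open Scope complex_scope.

(** * Powers of a square matrix and their stabilization at the index *)

Lemma expmxS (K : pzRingType) (n : nat) (M : 'M[K]_n) (k : nat) :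
  M ^+ k.+1 = M *m M ^+ k.
Proof. exact: exprS. Qed.

Lemma expmx_mulmxC (K : pzRingType) (q n : nat) (A : 'M[K]_(q, n))
    (W : 'M[K]_(n, q)) (k : nat) :
  (A *m W) ^+ k *m A = A *m (W *m A) ^+ k.
Proof.
elim: k => [|k IHk]; first by rewrite !expr0 [LHS]mul1mx [RHS]mulmx1.
by rewrite !exprS -!mulmxE -mulmxA IHk !mulmxA.
Qed.

Lemma mxpower_index_rank (F : fieldType) (n : nat) (M : 'M[F]_n) :
  \rank (M ^+ mxpower_index M) = \rank (M ^+ (mxpower_index M).+1).
Proof. by rewrite /mxpower_index; case: ex_minnP => k /eqP. Qed.

(** Equal ranks make the row spaces of both powers coincide, so [M ^+ j = L *m M ^+ j.+1];
    substituting this repeatedly raises the exponent at will. *)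
Lemma expmx_rank_factorl (F : fieldType) (n : nat) (M : 'M[F]_n) (j i : nat) :
  \rank (M ^+ j) = \rank (M ^+ j.+1) -> exists L, M ^+ j = L *m M ^+ (j + i).
Proof.
move=> rkM; have /submxP[L defMj] : (M ^+ j <= M ^+ j.+1)%MS.
  have subM : (M ^+ j.+1 <= M ^+ j)%MS by rewrite exprS submxMl.
  by rewrite -(mxrank_leqif_sup subM) rkM.
elim: i => [|i [L' IHi]]; first by exists 1%:M; rewrite addn0 mul1mx.
exists (L' *m L).
by rewrite addnS -addSn exprD -mulmxE mulmxA -[L' *m L *m _]mulmxA -defMj
  -mulmxA mulmxE -exprD IHi.
Qed.

Lemma trmx_exp (K : comPzRingType) (n : nat) (M : 'M[K]_n) (k : nat) :
  (M ^+ k)^T = M^T ^+ k.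
Proof.
elim: k => [|k IHk]; first by rewrite !expr0 trmx1.
by rewrite exprS exprSr -!mulmxE trmx_mul IHk.
Qed.

Lemma expmx_rank_factorr (F : fieldType) (n : nat) (M : 'M[F]_n) (j i : nat) :
  \rank (M ^+ j) = \rank (M ^+ j.+1) -> exists Q, M ^+ j = M ^+ (j + i) *m Q.
Proof.
rewrite -[\rank (M ^+ j)]mxrank_tr -[\rank (M ^+ j.+1)]mxrank_tr !trmx_exp.
case/(expmx_rank_factorl i) => L defMj; exists L^T.
by apply: trmx_inj; rewrite trmx_mul trmxK !trmx_exp.
Qed.

(** From the index on, kernels of powers stop growing, because [M ^+ k] is a left multiple of
    [M ^+ (k + l)]. Uniqueness of the minimizer rests on this. *)
Lemma expmx_ker_index (F : fieldType) (n p : nat) (M : 'M[F]_n)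
    (Z : 'M[F]_(n, p)) (k l : nat) :
  (mxpower_index M <= k)%N -> M ^+ (k + l) *m Z = 0 -> M ^+ k *m Z = 0.
Proof.
move=> le_jk MZ0.
have [L defMj] := expmx_rank_factorl (k - mxpower_index M + l)
  (mxpower_index_rank M).
rewrite -(subnK le_jk) exprD -mulmxE -mulmxA defMj addnA subnKC //.
by rewrite -[L *m _ *m Z]mulmxA MZ0 !mulmx0.
Qed.

(** * Adjoints and Gram matrices *)

Section Gramian.
Variable C : numClosedFieldType.

Lemma adjmx_mul (m n p : nat) (M : 'M[C]_(m, n)) (N : 'M[C]_(n, p)) :
  (M *m N) ^t* = N ^t* *m M ^t*.
Proof. by rewrite trmx_mul map_mxM. Qed.

Lemma mxtrace_gram (m n : nat) (M : 'M[C]_(m, n)) :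
  \tr (M ^t* *m M) = \sum_i \sum_j `|M i j| ^+ 2.
Proof.
rewrite exchange_big /=; apply: eq_bigr => j _; rewrite mxE.
by apply: eq_bigr => i _; rewrite !mxE normCKC.
Qed.

Lemma mxtrace_gram_eq0 (m n : nat) (M : 'M[C]_(m, n)) :
  \tr (M ^t* *m M) = 0 -> M = 0.
Proof.
rewrite mxtrace_gram => /eqP; have ge0 i j : 0 <= `|M i j| ^+ 2.
  by rewrite exprn_ge0.
rewrite psumr_eq0 => [/allP sum0|i _]; last by rewrite sumr_ge0.
apply/matrixP => i j; have := sum0 i (mem_index_enum _).
rewrite psumr_eq0 // => /allP/(_ j (mem_index_enum _)).
by rewrite sqrf_eq0 normr_eq0 mxE => /eqP.
Qed.

(** If [K] annihilates the Gram matrix from the left, then [M *m K ^t*] has zero Gram matrix, hence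
    vanishes, and a left inverse of [M] cancels [M]. *)
Lemma gram_unitmx (m n : nat) (M : 'M[C]_(m, n)) :
  row_full M -> M ^t* *m M \in unitmx.
Proof.
case/row_fullP=> N NM1; rewrite -row_free_unit -kermx_eq0.
set K := kermx _; have KM0 : M *m K ^t* = 0.
  apply: mxtrace_gram_eq0; rewrite adjmx_mul trmxCK -mulmxA [M ^t* *m _]mulmxA.
  by rewrite mulmxA mulmx_ker mul0mx mxtrace0.
have /(congr1 (mulmx N)) := KM0; rewrite mulmxA NM1 mul1mx mulmx0.
by move=> /(congr1 (fun X => X ^t*)); rewrite trmxCK trmx0 map_mx0 => ->.
Qed.

End Gramian.

(** * Frobenius norm, column ranges and the core-EP inverse *)

Section Complex.
Variable R : realType.

Lemma mx_frobenius_ge0 (m n : nat) (M : 'M[R[i]]_(m, n)) : 0 <= mx_frobenius M.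
Proof. exact: sqrtr_ge0. Qed.

Lemma mx_frobenius_gram (m n : nat) (M : 'M[R[i]]_(m, n)) :
  ((mx_frobenius M ^+ 2)%:C) = \tr (M ^t* *m M).
Proof.
rewrite sqr_sqrtr; last first.
  by apply: sumr_ge0 => i _; apply: sumr_ge0 => j _; apply: sqr_ge0.
rewrite mxtrace_gram rmorph_sum; apply: eq_bigr => i _.
by rewrite rmorph_sum; apply: eq_bigr => j _; rewrite rmorphXn.
Qed.

Lemma mx_frobenius_eq0 (m n : nat) (M : 'M[R[i]]_(m, n)) :
  mx_frobenius M = 0 -> M = 0.
Proof.
move=> M0; apply: mxtrace_gram_eq0.
by rewrite -mx_frobenius_gram M0 expr0n.
Qed.

Lemma mx_frobenius_pythagoras (m n : nat) (M N : 'M[R[i]]_(m, n)) :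
  M ^t* *m N = 0 ->
  mx_frobenius (M + N) ^+ 2 = mx_frobenius M ^+ 2 + mx_frobenius N ^+ 2.
Proof.
move=> MN0; apply: complexI; rewrite rmorphD /= !mx_frobenius_gram.
have NM0 : N ^t* *m M = 0.
  have /(congr1 (fun X => X ^t*)) := MN0.
  by rewrite adjmx_mul trmxCK trmx0 map_mx0.
rewrite [(M + N)^T]linearD map_mxD mulmxDl !mulmxDr MN0 NM0 addr0 add0r.
by rewrite mxtraceD.
Qed.

(** Range conditions are used below as factorizations; [Q] collects one chosen preimage for each
    column of [M]. *)
Lemma mx_range_subP (m n p : nat) (M : 'M[R[i]]_(m, n)) (N : 'M[R[i]]_(m, p)) :
  mx_range M `<=` mx_range N <-> exists Q, M = N *m Q.
Proof.
split=> [sub|[Q ->] _ [u _ <-]]; last by exists (Q *m u); rewrite ?mulmxA.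
have colM j : exists u, N *m u = col j M.
  by have [u _ <-] := sub _ (ex_intro2 _ _ (delta_mx j 0) I (esym (colE j M)));
     exists u.
have [f fM] := choice colM; exists (\matrix_(i, j) f j i 0).
apply/matrixP=> i j; have := congr1 (fun v : 'cV_m => v i 0) (fM j).
by rewrite !mxE => <-; apply: eq_bigr => l _; rewrite !mxE.
Qed.

Lemma mx_range_eqP (m n p : nat) (M : 'M[R[i]]_(m, n)) (N : 'M[R[i]]_(m, p)) :
  mx_range M = mx_range N <->
  (exists Q, M = N *m Q) /\ (exists Q, N = M *m Q).
Proof.
split=> [eqMN|[/mx_range_subP MN /mx_range_subP NM]]; last exact/seteqP.
by split; apply/mx_range_subP; rewrite eqMN.
Qed.

(* With U a basis of R(M^j), j the index, M acts on it as an invertible T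
   (M U = U T), and the core-EP inverse is U T^-1 (U^* U)^-1 U^*. *)
Lemma core_ep_exists (n : nat) (M : 'M[R[i]]_n) : exists X, is_core_ep M X.
Proof.
set j := mxpower_index M; set H := M ^+ j.
have [Q defH] := expmx_rank_factorr 1 (mxpower_index_rank M).
rewrite addn1 exprS -mulmxE -/j -/H in defH.
have [r [U [V [UV fullU freeV]]]] : exists r (U : 'M_(n, r)) (V : 'M_(r, n)),
    [/\ U *m V = H, row_full U & row_free V].
  exists (\rank H), (col_base H), (row_base H).
  by rewrite mulmx_base col_base_full row_base_free.
have /row_fullP[U' U'U] := fullU; have /row_freeP[V' VV'] := freeV.
have HV' : H *m V' = U by rewrite -UV -mulmxA VV' mulmx1.
(* Since [M] commutes with [H = U *m V], one gets [U T = H M V' = M H V' = M U]. *)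
pose T := V *m M *m V'.
have MU : M *m U = U *m T.
  rewrite /T !mulmxA UV -HV' !mulmxA; congr (_ *m _).
  by rewrite !mulmxE -exprS exprSr.
have [S TS] : exists S, T *m S = 1%:M.
  (* From [T = U' M U] and [M H Q = H] follows [T V Q = U' H = V], and [V'] cancels [V]. *)
  exists (V *m Q *m V').
  have defT : T = U' *m M *m U by rewrite -mulmxA MU mulmxA U'U mul1mx.
  have TVQ : T *m V *m Q = V.
    rewrite defT -[_ *m U *m V]mulmxA UV -2!mulmxA mulmxA -[U' *m M *m _]mulmxA.
    by rewrite [M *m _]mulmxA -defH -UV mulmxA U'U mul1mx.
  by rewrite !mulmxA TVQ.
have ST := mulmx1C TS.
set G := U ^t* *m U; have G_unit : G \in unitmx by exact: gram_unitmx.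
have GK : G *m invmx G = 1%:M by exact: mulmxV.
have KG : invmx G *m G = 1%:M by exact: mulVmx.
have GC : G ^t* = G by rewrite adjmx_mul trmxCK.
have adj1 p : (1%:M : 'M[R[i]]_p) ^t* = 1%:M by rewrite trmx1 map_mx1.
set K := invmx G in GK KG.
have [X defX] : exists X, X = U *m S *m K *m U ^t* by eexists.
have defXC : X ^t* = U *m (K ^t* *m S ^t* *m U ^t*).
  by rewrite defX !adjmx_mul trmxCK !mulmxA.
have XU : X *m U = U *m S by rewrite defX -mulmxA -/G -mulmxA KG mulmx1.
(* Both [X] and [X ^t*] begin with the factor [U]; this identity and [XUT] give the converse
   inclusions, so both ranges equal that of [U], which is that of [H]. *)
have XC_U : X ^t* *m (U *m K *m T ^t* *m G) = U.
  have KGC : K ^t* *m G = 1%:M by rewrite -GC -adjmx_mul GK adj1.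
  have SGKT : S ^t* *m T ^t* = 1%:M by rewrite -adjmx_mul TS adj1.
  rewrite defXC -!mulmxA [U ^t* *m (U *m _)]mulmxA -/G [G *m (K *m _)]mulmxA.
  by rewrite GK mul1mx [S ^t* *m _]mulmxA SGKT mul1mx KGC mulmx1.
have XUT : X *m (U *m T) = U by rewrite mulmxA XU -mulmxA ST mulmx1.
exists X; split.
- by rewrite {2}defX !mulmxA -[X *m M *m U]mulmxA MU XUT -defX.
- apply/mx_range_eqP; split.
    exists (U *m K *m T ^t* *m G *m (S *m K *m U ^t*)).
    by rewrite mulmxA XC_U defX !mulmxA.
  by exists (U *m T *m (K ^t* *m S ^t* *m U ^t*)); rewrite mulmxA XUT.
apply/mx_range_eqP; split.
  by exists (V' *m (K ^t* *m S ^t* *m U ^t*)); rewrite mulmxA HV'.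
by exists (U *m K *m T ^t* *m G *m V); rewrite mulmxA XC_U UV.
Qed.

(** Existence rules out the default value of [xget]. *)
Lemma core_epP (n : nat) (M : 'M[R[i]]_n) : is_core_ep M (core_ep M).
Proof. exact: (xgetPex 0 (core_ep_exists M)). Qed.

Lemma core_ep_range (n l : nat) (M : 'M[R[i]]_n) :
  exists Q, core_ep M = M ^+ (mxpower_index M + l) *m Q.
Proof.
have [_ eqC eqCC] := core_epP M; rewrite eqCC in eqC.
have /mx_range_eqP[[Q ->] _] := eqC.
have [Q' ->] := expmx_rank_factorr l (mxpower_index_rank M).
by exists (Q' *m Q); rewrite mulmxA.
Qed.

(** Source of the orthogonality in the theorem: a factor [(core_ep M) ^t*] on the left is orthogonal
    to everything that [core_ep M] kills. *)
Lemma core_ep_adj_range (n k : nat) (M : 'M[R[i]]_n) :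
  (mxpower_index M <= k)%N -> exists Z, M ^+ k = (core_ep M) ^t* *m Z.
Proof.
move=> le_jk; have [_ _ /mx_range_eqP[_ [Z defMj]]] := core_epP M.
exists (Z *m M ^+ (k - mxpower_index M)).
by rewrite mulmxA -defMj mulmxE -exprD subnKC.
Qed.

(** Write [C] for the inverse and [j] for the index. As [C M C = C] and [M ^+ j] factors through
    [C], the product [C M] fixes [M ^+ j]. With [C = M ^+ j.+1 *m Q'] this gives
    [C C = M ^+ j *m Q'], and one more [M] restores [C]. *)
Lemma mulmx_core_ep_sqr (n : nat) (M : 'M[R[i]]_n) :
  M *m (core_ep M *m core_ep M) = core_ep M.
Proof.
have [CMC eqC eqCC] := core_epP M; rewrite eqCC in eqC.
have /mx_range_eqP[_ [Q defMj]] := eqC.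
set j := mxpower_index M in defMj.
have CMM : core_ep M *m M ^+ j.+1 = M ^+ j.
  by rewrite exprS -mulmxE defMj !mulmxA CMC.
have [Q' defC] := core_ep_range 1 M; rewrite -/j addn1 in defC.
have CC : core_ep M *m core_ep M = M ^+ j *m Q'.
  by rewrite {2}defC mulmxA CMM.
by rewrite CC mulmxA mulmxE -exprS -mulmxE -defC.
Qed.

Lemma expmx_core_ep (n l : nat) (M : 'M[R[i]]_n) :
  M ^+ l *m core_ep M ^+ l.+1 = core_ep M.
Proof.
elim: l => [|l IHl]; first by rewrite expr0 mul1mx expr1.
rewrite [core_ep M ^+ _]exprS -mulmxE in IHl.
rewrite exprSr (exprD _ 2 l) expr2 -!mulmxE -!mulmxA.
by rewrite [core_ep M *m (_ *m _)]mulmxA [M *m _]mulmxA mulmx_core_ep_sqr.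
Qed.

(** * Reduction of weighted powers to ordinary powers of [W *m A] *)

Section WeightedProduct.
Variables (q n : nat) (W : 'M[R[i]]_(n, q)).

Lemma wexpS (X : 'M[R[i]]_(q, n)) (l : nat) :
  wexp W X l.+1 = X *m (W *m X) ^+ l.
Proof.
rewrite /wexp iteropS; elim: l => [|l IHl]; first by rewrite expr0 mulmx1.
by rewrite iterS IHl /wmul exprS -mulmxE !mulmxA.
Qed.

Lemma mulmx_wexp (X : 'M[R[i]]_(q, n)) (l : nat) :
  (0 < l)%N -> W *m wexp W X l = (W *m X) ^+ l.
Proof. by case: l => // l _; rewrite wexpS mulmxA exprS. Qed.

(** By [mulmx_core_ep_sqr], [W] times the weighted core-EP inverse is the core-EP inverse of
    [W *m A], so the weighted power collapses. Positivity of [m] avoids the default value of [wexp]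
    at [0]. *)
Lemma wm_weak_groupE (A : 'M[R[i]]_(q, n)) (m : nat) : (0 < m)%N ->
  wm_weak_group W m A = A *m core_ep (W *m A) ^+ m.+2 *m (W *m A) ^+ m.
Proof.
move=> m_gt0; rewrite /wm_weak_group -mulmxA mulmx_wexp // wexpS.
rewrite {2}/wcore_ep expr2 -mulmxE [W *m (A *m _)]mulmxA mulmx_core_ep_sqr.
rewrite /wcore_ep.
by rewrite -[A *m _ *m _]mulmxA mulmxE -exprD.
Qed.

Lemma wm_weak_group_image (A : 'M[R[i]]_(q, n)) (m : nat) : (0 < m)%N ->
  (W *m A) ^+ m.+1 *m W *m wm_weak_group W m A =
  W *m A *m core_ep (W *m A) *m (W *m A) ^+ m.
Proof.
move=> m_gt0; rewrite wm_weak_groupE //.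
(* Generalized because mulmxA would unfold the power into a product. *)
move: (core_ep _ ^+ m.+2) (expmx_core_ep m.+1 (W *m A)) => D ND.
rewrite !mulmxA -[_ *m W *m A]mulmxA -[_ ^+ m.+1 *m _]exprSr expmxS.
by rewrite -[_ *m _ *m D]mulmxA ND.
Qed.

(** The leading core-EP factor supplies [(W *m A) ^+ k], which moves across [A] to become
    [(A *m W) ^+ k]. *)
Lemma wm_weak_group_range (A : 'M[R[i]]_(q, n)) (m k : nat) : (0 < m)%N ->
  (mxpower_index (W *m A) <= k)%N ->
  exists Z, wm_weak_group W m A = (A *m W) ^+ k *m Z.
Proof.
move=> m_gt0 le_jk.
have [Q defC] := core_ep_range (k - mxpower_index (W *m A)) (W *m A).
rewrite subnKC // in defC.
exists (A *m (Q *m core_ep (W *m A) ^+ m.+1 *m (W *m A) ^+ m)).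
rewrite wm_weak_groupE // exprS -mulmxE {1}defC !mulmxA.
by rewrite expmx_mulmxC.
Qed.

End WeightedProduct.

End Complex.

Theorem theorem4p1 (R : realType) (q n p m : nat)
    (A : 'M[R[i]]_(q, n)) (W : 'M[R[i]]_(n, q)) (B : 'M[R[i]]_(n, p))
    (W_neq0 : W != 0) (m_gt0 : (0 < m)%N) :
  let k := maxn (mxpower_index (A *m W)) (mxpower_index (W *m A)) in
  let feasible :=
    [set X : 'M[R[i]]_(q, p) | mx_range X `<=` mx_range ((A *m W) ^+ k)] in
  let objective (X : 'M[R[i]]_(q, p)) :=
    mx_frobenius (W *m wexp W A m.+1 *m W *m X - W *m wexp W A m *m B) in
  is_minimizer feasible objective (wm_weak_group W m A *m B) /\
  (forall X, is_minimizer feasible objective X -> X = wm_weak_group W m A *m B).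
Proof.
move=> k feasible objective; set X0 := wm_weak_group W m A *m B.
have feasibleP X : feasible X <-> exists Y, X = (A *m W) ^+ k *m Y.
  exact: mx_range_subP.
have feasX0 : feasible X0.
  apply/feasibleP.
  have [Z defX0] := wm_weak_group_range m_gt0 (leq_maxr _ _ : _ <= k)%N.
  by exists (Z *m B); rewrite mulmxA -defX0.
(* A let-bound N would be unfolded by mulmxA. *)
have [N defN] : exists N, N = W *m A by eexists.
have le_Nk : (mxpower_index N <= k)%N by rewrite defN leq_maxr.
pose L X := N ^+ m.+1 *m W *m X : 'M[R[i]]_(n, p).
have LX0 : L X0 = N *m core_ep N *m N ^+ m *m B.
  by rewrite /L /X0 mulmxA defN wm_weak_group_image.
have split_obj X : feasible X ->
  objective X ^+ 2 = mx_frobenius (L (X - X0)) ^+ 2 + objective X0 ^+ 2.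
  move=> /feasibleP[Y defX]; have /feasibleP[Y0 defY0] := feasX0.
  rewrite -mx_frobenius_pythagoras; last first.
    have [Z defNk] := core_ep_adj_range le_Nk.
    (* Moving [W] across [(A *m W) ^+ k] produces [N ^+ k], which commutes with [N ^+ m.+1] and so
       comes to the front. *)
    have -> : L (X - X0) = (core_ep N) ^t* *m (Z *m N ^+ m.+1 *m W *m (Y - Y0)).
      rewrite !mulmxA -defNk mulmxE -exprD addnC exprD /L defX defY0 -mulmxBr.
      rewrite !mulmxA; congr (_ *m _); rewrite -!mulmxA.
      by rewrite defN -expmx_mulmxC mulmxA.
    rewrite adjmx_mul trmxCK -mulmxA !mulmx_wexp // -defN -/(L X0) LX0.
    have [CNC _ _] := core_epP N.
    by rewrite [core_ep N *m _]mulmxBr !mulmxA CNC subrr mulmx0.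
  by rewrite /objective !mulmx_wexp // -defN /L mulmxBr addrA subrK.
have le_obj X : feasible X -> objective X0 <= objective X.
  move=> /split_obj defX; rewrite -(@ler_pXn2r _ 2) // ?nnegrE
    ?mx_frobenius_ge0 //.
  by rewrite defX lerDr sqr_ge0.
split=> [//|X [feasX minX]].
have eq_obj : objective X = objective X0.
  by apply/eqP; rewrite eq_le minX // le_obj.
have /mx_frobenius_eq0 LX : mx_frobenius (L (X - X0)) = 0.
  have /eqP := split_obj X feasX; rewrite eq_obj -subr_eq subrr eq_sym.
  by rewrite sqrf_eq0 => /eqP.
have /feasibleP[Y defX] := feasX; have /feasibleP[Y0 defX0] := feasX0.
apply/eqP; rewrite -subr_eq0; apply/eqP.
rewrite defX defX0 -mulmxBr in LX *.
(* The exponent is [m.+2] because [A N ^+ m.+1 W = (A W) ^+ m.+2]: the extra [A] in front pairs with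
   the trailing [W]. *)
apply: (@expmx_ker_index _ _ _ _ _ _ m.+2); first exact: leq_maxl.
have /(congr1 (mulmx A)) := LX; rewrite mulmx0 /L defN !mulmxA -expmx_mulmxC.
by rewrite -[_ *m A *m W]mulmxA !mulmxE -exprSr -exprD addnC.
Qed.
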